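(* For every finite simple graph $G$, $\chi_2(G)-\chi(G)\le \frac{\alpha(G)+\omega(G)}{2}+3$.
   Context: $\chi(G)$ is the chromatic number, $\alpha(G)$ the independence number and $\omega(G)$ the clique number of $G$. A dynamic coloring of $G$ is a proper vertex coloring such that for every vertex $v$ of degree at least $2$, the neighbours of $v$ receive at least two different colors; $\chi_2(G)$ is the smallest number of colors in a dynamic coloring of $G$. *)

(* Defs.v *)
From mathcomp Require Import all_boot.

Set Implicit Arguments.
Unset Strict Implicit.
Unset Printing Implicit Defensive.

(* The vertex type may be empty. *)
Record sgraph := SGraph {
  vertex :> finType;
  adj : rel vertex;
  adj_sym : symmetric adj;
  adj_irrefl : irreflexive adj
}.

Section Graph.
Variable G : sgraph.

Definition nbhd (v : G) : {set G} := [set w | adj v w].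
Definition degree (v : G) : nat := #|nbhd v|.

Definition stable (A : {set G}) : bool :=
  [forall x in A, forall y in A, ~~ adj x y].

Definition clique (A : {set G}) : bool :=
  [forall x in A, forall y in A, (x != y) ==> adj x y].

Definition alpha : nat := \max_(A : {set G} | stable A) #|A|.
Definition omega : nat := \max_(A : {set G} | clique A) #|A|.

Definition proper_coloring (k : nat) (c : {ffun G -> 'I_k}) : bool :=
  [forall x, forall y, adj x y ==> (c x != c y)].

Definition dynamic_coloring (k : nat) (c : {ffun G -> 'I_k}) : bool :=
  proper_coloring c && [forall v, (1 < degree v) ==> (1 < #|c @: nbhd v|)].

(* A coloring with palette 'I_k need not use every color. *)
Definition colorable (k : nat) : bool :=
  [exists c : {ffun G -> 'I_k}, proper_coloring c].
Definition dyn_colorable (k : nat) : bool :=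
  [exists c : {ffun G -> 'I_k}, dynamic_coloring c].

Lemma ex_dyn_colorable : exists k, dyn_colorable k.
Proof.
exists #|G|; apply/existsP; exists [ffun x => enum_rank x].
have inj : injective [ffun x : G => enum_rank x].
  by move=> x y; rewrite !ffunE => /enum_rank_inj.
apply/andP; split.
  apply/forallP=> x; apply/forallP=> y; apply/implyP=> xy.
  by rewrite (inj_eq inj); apply: contraTneq xy => ->; rewrite adj_irrefl.
by apply/forallP=> v; apply/implyP=> dv; rewrite (card_imset _ inj).
Qed.

Lemma ex_colorable : exists k, colorable k.
Proof.
have [k /existsP[c /andP[cP _]]] := ex_dyn_colorable.
by exists k; apply/existsP; exists c.
Qed.

Definition chi : nat := ex_minn ex_colorable.
Definition chi2 : nat := ex_minn ex_dyn_colorable.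

End Graph.

(* Main.v *)
Require Import Defs.
From mathcomp Require Import all_boot all_order all_algebra.
From mathcomp Require Import lra.
Import Order.TTheory GRing.Theory Num.Theory.

(** Call a vertex of degree at least 2 bad for a proper coloring when its
    neighbourhood is monochromatic.

    Two extra colors suffice to make the bad vertices independent.  Let Q be the
    set of bad vertices whose neighbours have a larger color; Q is stable and
    meets every edge between bad vertices.  Give color a to a maximal subset Q'
    of Q containing no neighbourhood of a vertex of degree at least 2, and
    color b to the vertices having exactly one neighbour outside Q', if that
    neighbour is in Q.

    When the set B of bad vertices is independent, let U be a minimal set
    meeting the neighbourhood of every bad vertex, and recolor U with fresh
    colors, each used at most twice: two vertices of U may share a color unless
    they are adjacent or form the whole neighbourhood of some vertex.  Pairing
    greedily leaves a set K in which all pairs are in conflict, so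
    (|U| + |K|) / 2 fresh colors are used.  Let W be the set of vertices having
    exactly two neighbours, both in K.  Deleting from K one neighbour of each
    element of W leaves a clique, hence |K| <= omega + |W|.  By minimality each
    u in U has a bad neighbour with no other neighbour in U, and these |U|
    vertices together with W form a stable set, hence |U| + |W| <= alpha. *)

Section Colorings.
Set Implicit Arguments.
Unset Strict Implicit.
Unset Printing Implicit Defensive.

Variable G : sgraph.
Implicit Types (u v w x y : G) (A U : {set G}).

(** * Colorings with arbitrary palettes and monochromatic neighbourhoods *)

Definition proper (T : eqType) (c : G -> T) :=
  forall x y, adj x y -> c x != c y.

Definition bad (T : eqType) (c : G -> T) v :=
  (1 < degree v) && [forall x in nbhd v, forall y in nbhd v, c x == c y].

Lemma badP (T : eqType) (c : G -> T) v :
  reflect (1 < degree v /\ forall x y, adj v x -> adj v y -> c x = c y)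
          (bad c v).
Proof.
apply: (iffP andP) => -[dv mono]; split=> //.
  move=> x y vx vy.
  have /forall_inP/(_ x) := mono; rewrite inE => /(_ vx).
  by move/forall_inP/(_ y); rewrite inE => /(_ vy)/eqP.
apply/forall_inP=> x; rewrite inE => vx.
by apply/forall_inP=> y; rewrite inE => vy; apply/eqP/mono.
Qed.

Lemma degree_gt0P v : reflect (exists x, adj v x) (0 < degree v).
Proof.
by apply: (iffP card_gt0P) => -[x]; [rewrite inE | move=> vx]; exists x;
   rewrite ?inE.
Qed.

(** Counting only the colors in the image permits an oversized palette such as [T + G], where
    vertices serve as names of fresh colors. *)
Lemma chi2_leq (T : finType) (c : G -> T) :
  proper c -> (forall v, ~~ bad c v) -> chi2 G <= #|[set c x | x in G]|.
Proof.
move=> c_proper c_good; rewrite /chi2; case: ex_minnP => m _; apply.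
set S := [set c x | x in G].
have cS x : c x \in S by apply: imset_f.
pose d x : 'I_#|S| := enum_rank_in (cS x) (c x).
have dE x y : d x = d y -> c x = c y by apply: enum_rank_in_inj.
apply/existsP; exists [ffun x => d x]; apply/andP; split.
  apply/forallP=> x; apply/forallP=> y; apply/implyP=> /c_proper.
  by rewrite !ffunE; apply: contraNneq => /dE ->.
apply/forallP=> v; apply/implyP=> dv; rewrite ltnNge.
apply: contra (c_good v) => mono; apply/badP; split=> // x y vx vy.
have in_im z : adj v z -> d z \in [ffun x => d x] @: nbhd v.
  by move=> vz; apply/imsetP; exists z; rewrite ?inE ?ffunE.
exact/dE/(card_le1_eqP mono _ _ (in_im _ vy) (in_im _ vx)).
Qed.

Lemma stable_leq_alpha A : (forall x y, x \in A -> y \in A -> ~~ adj x y) ->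
  #|A| <= alpha G.
Proof.
move=> st; apply: (@leq_bigmax_cond _ _ (fun A : {set G} => #|A|)).
by apply/forall_inP=> x xA; apply/forall_inP=> y yA; apply: st.
Qed.

Lemma clique_leq_omega A :
  (forall x y, x \in A -> y \in A -> x != y -> adj x y) -> #|A| <= omega G.
Proof.
move=> cl; apply: (@leq_bigmax_cond _ _ (fun A : {set G} => #|A|)).
apply/forall_inP=> x xA; apply/forall_inP=> y yA.
by apply/implyP; apply: cl.
Qed.

(** * Making the bad vertices independent with two extra colors *)

Lemma two_colors_make_bad_stable k (c : G -> 'I_k) : proper c ->
  exists2 c' : G -> option (option 'I_k), proper c' &
    forall x y, adj x y -> bad c' x -> ~~ bad c' y.
Proof.
move=> c_proper.
pose Q := [set v | bad c v && [exists w in nbhd v, c v < c w]].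
(* All neighbours of a bad vertex share one color, so two adjacent members of [Q] would each have a
   smaller color than the other. *)
have Q_stable x y : x \in Q -> y \in Q -> ~~ adj x y.
  rewrite !inE => /andP[/badP[_ mx] /existsP[x' /andP[]]].
  rewrite inE => xx' lx /andP[/badP[_ my] /existsP[y' /andP[]]].
  rewrite inE => yy' ly; apply/negP=> xy.
  have yx : adj y x by rewrite adj_sym.
  move: lx ly; rewrite (mx _ _ xx' xy) (my _ _ yy' yx).
  by move/ltn_trans=> H /H; rewrite ltnn.
pose P A := (A \subset Q)
  && [forall x : G, (1 < degree x) ==> ~~ (nbhd x \subset A)].
have [Q' /maxsetP[/andP[Q'Q /forallP Q'P] Q'max]] : {A | maxset P A}.
  apply: ex_maxset; exists set0; rewrite /P sub0set; apply/forallP=> x.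
  by apply/implyP; apply: contraTN => /subset_leq_card; rewrite cards0 -ltnNge ltnS;
     apply: leqW.
pose R := [set x | (1 < degree x)
  && [exists q in Q :\: Q', nbhd x \subset q |: Q']].
have RQ x y : x \in R -> adj x y -> y \in Q.
  rewrite inE => /andP[_ /existsP[q /andP[]]]; rewrite in_setD.
  case/andP=> _ qQ /subsetP/(_ y); rewrite [y \in nbhd x]inE => H /H.
  by rewrite in_setU1 => /predU1P[-> // | /(subsetP Q'Q)].
have R_hits x : x \in R -> exists2 y, adj x y & y \in Q'.
  rewrite inE => /andP[dx /existsP[q /andP[_ sub]]].
  have /card_gt0P[y] : 0 < #|nbhd x :\ q|.
    by move: dx; rewrite /degree (cardsD1 q); case: (q \in _) => //= /ltnW.
  rewrite !inE => /andP[yq xy]; exists y => //.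
  have /(subsetP sub) : y \in nbhd x by rewrite inE.
  by rewrite in_setU1 (negPf yq).
(* By maximality, adding [q] to [Q'] swallows some neighbourhood [nbhd x]; then [x] is in [R], and
   [q] is in [nbhd x] since [Q'] alone does not contain it. *)
have Q_hits q : q \in Q -> q \notin Q' -> exists2 x, adj q x & x \in R.
  move=> qQ qQ'.
  have : ~~ P (q |: Q').
    apply/negP=> /Q'max/(_ (subsetUr _ _)) E.
    by move: qQ'; rewrite -E setU11.
  rewrite /P subUset sub1set qQ Q'Q /= => /forallPn[x].
  rewrite negb_imply negbK => /andP[dx sub].
  have xR : x \in R.
    rewrite inE dx; apply/existsP; exists q.
    by rewrite in_setD qQ qQ' sub.
  exists x => //; rewrite adj_sym; apply: contraTT (Q'P x) => xq.
  rewrite dx negbK /=; apply/subsetP=> y xy; have := subsetP sub y xy.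
  rewrite in_setU1 => /predU1P[E|//]; move: xy; rewrite inE E => yq.
  by rewrite yq in xq.
pose c' v := if v \in Q' then None else
             if v \in R then Some None else Some (Some (c v)).
(* One neighbour colored [None] would force [None] on all of them, hence [nbhd y] inside [Q']. *)
have bad_Q' y x : bad c' y -> adj y x -> x \notin Q'.
  move=> /badP[dy my] yx; apply/negP=> xQ'.
  have := Q'P y; rewrite dy => /subsetPn[z]; rewrite inE => yz zQ'.
  by have := my _ _ yx yz; rewrite /c' xQ' (negPf zQ'); case: ifP.
have bad_R y : y \in R -> ~~ bad c' y.
  by case/R_hits=> x yx xQ'; apply/negP=> /bad_Q'/(_ yx); rewrite xQ'.
(* Otherwise [z] shares the color [Some None] of [x], so [z] is in [R] and cannot be bad. *)
have bad_nbhd_R y z x :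
  bad c' y -> bad c' z -> adj y z -> adj y x -> x \notin R.
  move=> by' bz yz yx; apply/negP=> xR; have /badP[_ my] := by'.
  have := my _ _ yx yz; rewrite /c' !(negPf (bad_Q' _ _ by' _)) // xR.
  by case: ifP => // zR; rewrite (negPf (bad_R _ zR)) in bz.
have bad_old y z : bad c' y -> bad c' z -> adj y z -> bad c y.
  move=> by' bz yz; have /badP[dy my] := by'.
  apply/badP; split=> // x x' yx yx'.
  have := my _ _ yx yx'; rewrite /c' !(negPf (bad_Q' _ _ by' _)) //.
  by rewrite !(negPf (bad_nbhd_R _ _ _ by' bz yz _)) // => -[].
exists c' => [x y xy|y z yz by'].
  have yx : adj y x by rewrite adj_sym.
  rewrite /c'; case: (boolP (x \in Q')) => xQ'; case: (boolP (y \in Q')) => yQ'.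
  - by have := Q_stable x y; rewrite xy !(subsetP Q'Q) // => /(_ isT isT).
  - by case: ifP.
  - by case: ifP.
  case: (boolP (x \in R)) => xR; case: (boolP (y \in R)) => yR //.
    by have := Q_stable x y; rewrite xy (RQ _ _ xR xy) (RQ _ _ yR yx) => /(_ isT isT).
  exact: c_proper.
(* Here [u] is in [Q] by its old color and outside [Q'] because its neighbour [v] is bad, so
   [Q_hits] gives it a neighbour in [R], which [bad_nbhd_R] forbids. *)
have lower_notbad u v : adj u v -> bad c' u -> bad c' v -> c u < c v -> False.
  move=> uv bu bv luv; have vu : adj v u by rewrite adj_sym.
  have uQ : u \in Q.
    rewrite inE (bad_old u v) //; apply/existsP; exists v.
    by rewrite inE uv.
  have [x ux xR] := Q_hits _ uQ (bad_Q' _ _ bv vu).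
  by have := bad_nbhd_R _ _ _ bu bv uv ux; rewrite xR.
apply/negP=> bz; have zy : adj z y by rewrite adj_sym.
have : c y != c z := c_proper _ _ yz.
rewrite neq_ltn => /orP[]; exact: lower_notbad.
Qed.

(** * Pairing non-conflicting vertices, and minimal hitting sets *)

(** The map [f] names color classes by representatives. Removing [p] non-conflicting pairs until [K]
    remains gives [|U| = 2p + |K|] and at most [p + |K|] classes. *)
Lemma greedy_pairing (e : rel G) U : symmetric e ->
  exists f : G -> G, exists2 K : {set G},
    [/\ K \subset U, forall x y, x \in K -> y \in K -> x != y -> e x y
      & (#|f @: U|).*2 <= #|U| + #|K|] &
    [/\ forall x, x \in U -> f x \in U,
        forall x y, x \in U -> y \in U -> x != y -> f x = f y -> ~~ e x y
      & forall x y z, x \in U -> y \in U -> z \in U -> x != y ->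
          f x = f y -> f x = f z -> z = x \/ z = y].
Proof.
move=> e_sym; have [n] := ubnP #|U|; elim: n U => // n IHn U /ltnSE leUn.
have [cl|] := boolP [forall x in U, forall y in U, (x != y) ==> e x y].
  exists id, U; last first.
    by split=> // [x y _ _ /eqP|x y z _ _ _ /eqP].
  split=> // [x y xU yU xy|]; last by rewrite imset_id addnn.
  by have /forall_inP/(_ x xU)/forall_inP/(_ y yU)/implyP := cl; apply.
case/forall_inPn=> a aU /forall_inPn[b bU]; rewrite negb_imply => /andP[ab nab].
have cardU : #|U| = (#|U :\: [set a; b]|).+2.
  have sub : [set a; b] \subset U by rewrite subUset !sub1set aU.
  by rewrite -(cardsID [set a; b] U) (setIidPr sub) cards2 ab.
have [|f [K [KU Kcl cardf] [fU f_indep f_le2]]] := IHn (U :\: [set a; b]).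
  by rewrite cardU in leUn; apply: ltnW.
pose isab x := (x == a) || (x == b).
have inD x : x \in U -> ~~ isab x -> x \in U :\: [set a; b].
  by rewrite in_setD in_set2 => -> ->.
(* The name [a] is fresh: [f] maps the rest of [U] into itself, which omits [a]. *)
pose g x := if isab x then a else f x.
have g_a x y : x \in U -> y \in U -> g x = g y -> isab x = isab y.
  have aux z : z \in U -> ~~ isab z -> f z <> a.
    by move=> zU /(inD _ zU)/fU; rewrite !inE => /andP[/norP[/eqP]].
  move=> xU yU; rewrite /g; case: ifPn => [xa|xa]; case: ifPn => [ya|ya] // E.
    by case: (aux _ yU ya).
  by case: (aux _ xU xa).
exists g, K; split=> //.
- exact: subset_trans KU (subsetDl _ _).
- have sub : g @: U \subset a |: f @: (U :\: [set a; b]).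
    apply/subsetP=> _ /imsetP[x xU ->]; rewrite /g.
    case: ifPn => [_|xab]; first exact: setU11.
    by rewrite in_setU1 imset_f ?orbT ?inD.
  have := subset_leq_card sub; rewrite cardsU1 -leq_double.
  move/leq_trans; apply; rewrite cardU doubleD 2!addSn -addn2 addnC leq_add //.
  by case: (_ \notin _).
- move=> x xU; rewrite /g; case: ifPn => // xab.
  by have := fU x (inD _ xU xab); rewrite inE => /andP[].
- move=> x y xU yU xy E; have Eab := g_a _ _ xU yU E; move: E; rewrite /g -Eab.
  case: ifPn => [xab _|xab E]; last by apply: f_indep E => //; apply: inD; rewrite -?Eab.
  rewrite xab in Eab; move: xab Eab xy; rewrite /isab.
  by case/orP=> /eqP-> /esym/orP[] /eqP->; rewrite ?eqxx // => _; rewrite e_sym.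
move=> x y z xU yU zU xy Exy Exz.
have Eab := g_a _ _ xU yU Exy; have Eac := g_a _ _ xU zU Exz.
move: Exy Exz; rewrite /g -Eab -Eac; case: ifPn => xab.
  rewrite xab in Eab Eac; move: xab Eab Eac xy; rewrite /isab.
  case/orP=> /eqP-> /esym/orP[] /eqP-> /esym/orP[] /eqP->; rewrite ?eqxx //; auto.
by move=> E1 E2; apply: f_le2 E1 E2 => //; apply: inD; rewrite -?Eab -?Eac.
Qed.

(** If [U] is minimal under inclusion, deleting [u] leaves some [v] of [B] unhit, so [u] is the only
    neighbour of [v] in [U]. *)
Lemma minimal_hitting_set (B : {set G}) : (forall v, v \in B -> 0 < degree v) ->
  exists U : {set G},
    (forall v, v \in B -> exists2 u, u \in U & adj v u) /\
    (forall u, u \in U -> exists2 v, v \in B & nbhd v :&: U = [set u]).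
Proof.
move=> Bdeg.
pose hits U := [forall v in B, [exists u in U, adj v u]].
have [|U /minsetP[/forall_inP hitU minU]] := @ex_minset _ hits.
  exists setT; apply/forall_inP=> v /Bdeg/degree_gt0P[u vu].
  by apply/existsP; exists u; rewrite inE.
exists U; split=> [v /hitU/exists_inP //|u uU].
have : ~~ hits (U :\ u).
  apply/negP=> /minU/(_ (subsetDl _ _)) E.
  by have := setD11 u U; rewrite E uU.
case/forall_inPn=> v vB /exists_inPn noU; exists v => //.
have uniq_u x : x \in U -> adj v x -> x = u.
  move=> xU vx; apply/eqP; apply: contraTT vx => xu.
  by apply: noU; rewrite in_setD1 xu.
have /exists_inP[x xU vx] := hitU _ vB.
apply/setP=> y; rewrite in_setI in_set1 inE; apply/andP/eqP => [[vy yU]|->].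
  exact: uniq_u.
by rewrite -(uniq_u _ xU vx).
Qed.

(** * Recoloring a hitting set when the bad vertices are independent *)

Lemma chi2_leq_of_bad_stable (T : finType) (c : G -> T) : proper c ->
  (forall x y, adj x y -> bad c x -> ~~ bad c y) ->
  (chi2 G).*2 <= #|T|.*2 + (alpha G + omega G).
Proof.
move=> c_proper bad_stable.
have [|U [hitU privU]] := @minimal_hitting_set [set v | bad c v].
  by move=> v; rewrite inE => /badP[/ltnW].
pose e x y := adj x y || [exists w, nbhd w == [set x; y]].
have e_sym : symmetric e.
  move=> x y; rewrite /e adj_sym; congr (_ || _).
  by apply: eq_existsb => w; rewrite setUC.
have [f [K [KU Kcl cardf] [fU f_indep f_le2]]] := greedy_pairing U e_sym.
have chi2_le : chi2 G <= #|T| + #|f @: U|.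
  pose c' v : T + G := if v \in U then inr (f v) else inl (c v).
  have c'_proper : proper c'.
    move=> x y xy; rewrite /c'; case: ifP => xU; case: ifP => yU //.
      apply/eqP=> -[fxy]; have xney : x != y.
        by apply: contraTneq xy => ->; rewrite adj_irrefl.
      by have := f_indep x y xU yU xney fxy; rewrite /e xy.
    by apply: contraNneq (c_proper _ _ xy) => -[->].
  have c'_good v : ~~ bad c' v.
    apply/negP=> /badP[dv mono].
    have [/exists_inP[u uU vu]|/exists_inPn noU] :=
      boolP [exists u in U, adj v u].
      (* A fresh color occurs at most twice, so if [v] sees only that color then [nbhd v] is a pair
         of equally colored vertices, which [e] declares in conflict. *)
      have all_U x : adj v x -> x \in U /\ f u = f x.
        move=> vx; have := mono _ _ vu vx; rewrite /c' uU.
        by case: ifP => // _ [].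
      have /card_gt0P[x] : 0 < #|nbhd v :\ u|.
        by move: dv; rewrite /degree (cardsD1 u); case: (u \in _) => //= /ltnW.
      rewrite !inE => /andP[xu vx]; have [xU fx] := all_U _ vx.
      rewrite eq_sym in xu.
      have := f_indep u x uU xU xu fx; rewrite /e negb_or => /andP[_].
      case/existsPn/(_ v)/negP; apply/eqP/setP=> z; rewrite in_set2 inE.
      apply/idP/orP => [vz|[]/eqP-> //].
      have [zU fz] := all_U _ vz.
      by case: (f_le2 u x z uU xU zU xu fx fz) => ->; rewrite eqxx; [left|right].
    have outU x : adj v x -> x \in U = false.
      by move=> vx; apply: contraTF vx; apply: noU.
    have [|u uU vu] := hitU v; last by rewrite outU in uU.
    rewrite inE; apply/badP; split=> // x y vx vy.
    by have := mono _ _ vx vy; rewrite /c' !outU // => -[].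
  apply: leq_trans (chi2_leq c'_proper c'_good) _.
  have sub : [set c' x | x in G] \subset
             [set inl t | t in T] :|: [set inr g | g in f @: U].
    apply/subsetP=> _ /imsetP[x _ ->]; rewrite in_setU /c'; case: ifP => xU.
      by rewrite orbC imset_f // imset_f.
    by rewrite imset_f.
  apply: leq_trans (subset_leq_card sub) _.
  apply: leq_trans (leq_card_setU _ _) _.
  by rewrite leq_add // leq_imset_card.
pose p u := odflt u [pick v | bad c v && (nbhd v :&: U == [set u])].
have pP u : u \in U -> bad c (p u) /\ nbhd (p u) :&: U = [set u].
  move=> uU; rewrite /p; case: pickP => [v /andP[bv /eqP] //|/= none].
  by have [v] := privU u uU; rewrite inE => bv E; have := none v; rewrite bv E eqxx.
have p_adj u : u \in U -> adj (p u) u.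
  by case/pP=> _ /setP/(_ u); rewrite in_set1 eqxx in_setI inE => /andP[].
have bad_notU v : bad c v -> v \notin U.
  move=> bv; apply/negP=> vU; have := bad_stable _ _ (p_adj _ vU).
  by have [-> _] := pP _ vU; rewrite bv => /(_ isT).
pose W := [set w | (nbhd w \subset K) && (degree w == 2)].
have W_nbhd w x : w \in W -> adj w x -> x \in U.
  rewrite inE => /andP[/subsetP sub _] wx; apply: (subsetP KU).
  by apply: sub; rewrite inE.
(* If [w] were in [U], then [p w], being a neighbour of [w], would be a bad vertex in [U]. *)
have W_notU w : w \in W -> w \notin U.
  move=> wW; apply/negP=> wU; have [bp _] := pP _ wU.
  have := bad_notU _ bp; rewrite (W_nbhd w) // adj_sym.
  exact: p_adj.
have p_inj : {in U &, injective p}.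
  move=> x y xU yU E; have [_ Ex] := pP _ xU; have [_] := pP _ yU.
  by rewrite -E Ex => /set1_inj.
(* The vertex [p u] has a single neighbour in [U], whereas members of [W] have two. *)
have disj : [disjoint p @: U & W].
  rewrite disjoint_subset; apply/subsetP=> _ /imsetP[u uU ->].
  rewrite !inE; apply/negP=> /andP[sub /eqP dp].
  have [_] := pP _ uU; rewrite (setIidPl (subset_trans sub KU)) => E.
  by move: dp; rewrite /degree E cards1.
have cardUW : #|U| + #|W| <= alpha G.
  have -> : #|U| + #|W| = #|p @: U :|: W|.
    by rewrite cardsU disjoint_setI0 // cards0 subn0 card_in_imset.
  (* All neighbours of [w] lie in [U], which both [p @: U] and [W] avoid. *)
  have W_indep w x : w \in W -> x \in p @: U :|: W -> ~~ adj w x.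
    move=> wW xPW; apply/negP=> /(W_nbhd _ _ wW) xU.
    move: xPW; rewrite in_setU => /orP[/imsetP[u uU E]|/W_notU]; last by rewrite xU.
    by have [/bad_notU] := pP _ uU; rewrite -E xU.
  apply: stable_leq_alpha => x y.
  rewrite in_setU => /orP[/imsetP[u uU ->]|]; last exact: W_indep.
  rewrite in_setU => /orP[/imsetP[v vU ->]|yW]; last first.
    by rewrite adj_sym W_indep // in_setU imset_f.
  have [bu _] := pP _ uU; have [bv _] := pP _ vU.
  by apply: contraL bv => /bad_stable; apply.
have cardK : #|K| <= omega G + #|W|.
  (* Deleting the chosen neighbours [g w] breaks every conflict within [K] that is not an edge. *)
  pose g w := odflt w [pick x in nbhd w].
  have gP w : w \in W -> g w \in nbhd w.
    rewrite inE /g => /andP[_ dw]; case: pickP => //= none.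
    by move: dw; rewrite /degree (eq_card0 none).
  rewrite -(cardsID (g @: W) K) addnC leq_add //; last first.
    by apply: leq_trans (subset_leq_card (subsetIr _ _)) (leq_imset_card _ _).
  apply: clique_leq_omega => x y; rewrite !in_setD.
  case/andP=> xg xK /andP[yg yK] xy; have := Kcl _ _ xK yK xy.
  case/orP=> // /existsP[w /eqP Ew].
  have wW : w \in W.
    by rewrite inE /degree Ew cards2 xy subUset !sub1set xK yK.
  have := gP _ wW; rewrite Ew in_set2 => /orP[] /eqP E.
    by rewrite -E imset_f in xg.
  by rewrite -E imset_f in yg.
rewrite -leq_double doubleD in chi2_le.
apply: leq_trans chi2_le _; rewrite leq_add2l.
apply: leq_trans cardf _; apply: leq_trans (leq_add (leqnn _) cardK) _.
by rewrite addnCA addnC leq_add2r.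
Qed.

End Colorings.

Local Open Scope ring_scope.

Theorem theorem6 (G : sgraph) :
  (chi2 G)%:R - (chi G)%:R <= ((alpha G)%:R + (omega G)%:R) / 2%:R + 3%:R :> rat.
Proof.
(* Doubling keeps the inequality in the naturals; the two extra colors yield the constant 2, which
   is below the required 3. *)
have bound : ((chi2 G).*2 <= (chi G).+2.*2 + (alpha G + omega G))%N.
  rewrite /chi; case: ex_minnP => k /existsP[c /forallP c_proper] _.
  have [x y xy|c' c'_proper bad_stable] := @two_colors_make_bad_stable G k c.
    by have /forallP/(_ y)/implyP := c_proper x; apply.
  by have := chi2_leq_of_bad_stable c'_proper bad_stable; rewrite !card_option card_ord.
rewrite -(ler_nat rat) -!mul2n !natrD !natrM in bound.
lra.
Qed.
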